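(* Let $R$ be a commutative ring with unit. Let $(G_n,w_n)$, $n=1,2,\ldots$, be a finite or countable sequence of weighted digraphs with non-vanishing weights in $R$, together with a sequence of morphisms of weighted digraphs $f_n:(G_n,w_n)\longrightarrow(G_{n+1},w_{n+1})$. For each $n$ let $\iota_n:\Omega^{w_n}_*(G_n)\longrightarrow\Gamma^{w_n}_*(G_n)$ be the canonical inclusion. Then the canonical inclusion $(\iota_1,\iota_2,\ldots)$ of the persistence complex $\{\Omega^{w_n}_*(G_n),(f_n)_\#\}_{n\ge1}$ into the persistence complex $\{\Gamma^{w_n}_*(G_n),(f_n)_\#\}_{n\ge1}$ induces, for each $p\ge 0$, the identity map from the persistence $R$-module $$H_p(G_1,w_1;R)\xrightarrow{(f_1)_*}\cdots\xrightarrow{(f_{n-1})_*}H_p(G_n,w_n;R)\xrightarrow{(f_n)_*}H_p(G_{n+1},w_{n+1};R)\xrightarrow{(f_{n+1})_*}\cdots$$ (the persistent weighted path homology) to itself.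
   Context: A digraph $G=(V,E)$ consists of a finite nonempty set $V$ and a set $E$ of ordered pairs $(u,v)\in V\times V$ with $u\ne v$; write $u\to v$ for $(u,v)\in E$. A weight on $G$ is a function $w:V\to R$; it is non-vanishing if $w(i)\neq 0$ for all $i\in V$. The pair $(G,w)$ is a weighted digraph. For $p\ge 0$, $\Lambda_p(V)$ is the free $R$-module on all sequences (elementary $p$-paths) $e_{i_0\cdots i_p}$, $i_k\in V$; $\Lambda_{-1}(V)=R$ (generated by the empty path). An elementary path is regular if $i_k\ne i_{k+1}$ for all $k$, otherwise non-regular. $\mathcal R_p(V)$ and $\mathcal I_p(V)$ are the submodules of $\Lambda_p(V)$ generated by the regular, resp. non-regular, elementary $p$-paths, and $\mathcal R_p(V)\cong\Lambda_p(V)/\mathcal I_p(V)$. The weighted boundary operator is $\partial^w e_{i_0\cdots i_p}=\sum_{q=0}^p(-1)^q w(i_q)\,e_{i_0\cdots\widehat{i_q}\cdots i_p}$, extended linearly; it induces $\partial^w:\mathcal R_p(V)\to\mathcal R_{p-1}(V)$ through this isomorphism (i.e. non-regular terms are set to $0$), with $\partial^w\partial^w=0$. An elementary path $e_{i_0\cdots i_p}$ is allowed on $G$ if $i_{k-1}\to i_k$ for all $k=1,\dots,p$. $\mathcal A_p(G)\subseteq\mathcal R_p(V)$ is the submodule generated by allowed elementary $p$-paths ($\mathcal A_{-1}(G)=R$). Put $\Omega^w_p(G)=\{v\in\mathcal A_p(G):\partial^w v\in\mathcal A_{p-1}(G)\}$ and $\Gamma^w_p(G)=\mathcal A_p(G)+\partial^w\mathcal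 A_{p+1}(G)$; both are chain complexes under $\partial^w$ and $\Omega^w_p(G)\subseteq\Gamma^w_p(G)$. Homology is that of the truncated complexes (degrees $p\ge 0$, with $\partial^w$ replaced by $0$ on degree $0$). The weighted path homology $H_p(G,w;R)$, $p\ge0$, is the homology of $\Omega^w_*(G)$; the canonical inclusion $\Omega^w_*(G)\to\Gamma^w_*(G)$ induces an isomorphism on homology, so $H_p(G,w;R)$ can be constructed either as the homology of $\Omega^w_*(G)$ or as the homology of $\Gamma^w_*(G)$, and it denotes both. A morphism of weighted digraphs $f:(G,w)\to(G',w')$, with $G'=(V',E')$, is a map $f:V\to V'$ such that $i\to j$ in $G$ implies $f(i)\to f(j)$ in $G'$ or $f(i)=f(j)$, and $w(i)=w'(f(i))$ for all $i\in V$. The induced map $f_\#:\mathcal R_p(V)\to\mathcal R_p(V')$ sends $e_{i_0\cdots i_p}$ to $e_{f(i_0)\cdots f(i_p)}$ if the latter is regular and to $0$ otherwise; it restricts to chain maps $\Omega^w_*(G)\to\Omega^{w'}_*(G')$ and $\Gamma^w_*(G)\to\Gamma^{w'}_*(G')$, and $f_*$ denotes the induced map on weighted path homology. A persistence $R$-module is a sequence of $R$-modules $M_n$ with homomorphisms $M_n\to M_{n+1}$; a persistence complex is a sequence of chain complexes with chain maps between consecutive ones. Each of the two persistence complexes in the claim induces the displayed persistence $R$-module on homology. *)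

(* Defs.v *)
From HB Require Import structures.
From mathcomp Require Import all_boot all_order all_algebra.
From mathcomp Require Import generic_quotient ring_quotient boolp zify ring.

Set Implicit Arguments.
Unset Strict Implicit.
Unset Printing Implicit Defensive.

Import GRing.Theory.
Local Open Scope ring_scope.

Section Submodule.
Variables (R : pzRingType) (V : lmodType R) (S : submodClosed V).

Record submodule := Submodule {submodule_val :> V; _ : submodule_val \in S}.

HB.instance Definition _ := [isSub for submodule_val].
HB.instance Definition _ := [Choice of submodule by <:].
HB.instance Definition _ := [SubChoice_isSubLmodule of submodule by <:].

End Submodule.

Section QuotientModule.
Variables (R : pzRingType) (V : lmodType R) (S : submodClosed V).
Local Open Scope quotient_scope.

Definition submod_mem (x : V) : bool := x \in S.
Fact quotmod_subproof : zmod_closed submod_mem.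
Proof. exact: GRing.subsemimod_closedB (GRing.subsemimodClosedP S). Qed.
HB.instance Definition _ := GRing.isZmodClosed.Build V submod_mem quotmod_subproof.

Local Notation I := (GRing.ZmodClosed.clone V submod_mem _).

Definition quotmod := Quotient.quot I.

HB.instance Definition _ := GRing.Zmodule.on quotmod.

Definition quot_proj (x : V) : quotmod := \pi_(Quotient.quot I) x.
Definition quot_repr (x : quotmod) : V := repr (x : Quotient.quot I).

Lemma quot_reprK : cancel quot_repr quot_proj.
Proof. exact: reprK. Qed.

Lemma quot_projP x y : quot_proj x = quot_proj y <-> x - y \in S.
Proof.
by rewrite (Quotient.idealrBE I x y); split=> [xy|/eqP//]; apply/eqP.
Qed.

Lemma quot_projD x y : quot_proj (x + y) = quot_proj x + quot_proj y.
Proof. exact: (raddfD (\pi_(Quotient.quot I))). Qed.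

Definition quot_scale (a : R) (x : quotmod) := quot_proj (a *: quot_repr x).

Lemma quot_scaleE a x : quot_scale a (quot_proj x) = quot_proj (a *: x).
Proof.
apply/quot_projP; rewrite -scalerBr rpredZ //.
by apply/quot_projP; rewrite quot_reprK.
Qed.

Fact quot_scaleA a b x : quot_scale a (quot_scale b x) = quot_scale (a * b) x.
Proof. by rewrite -[x]quot_reprK !quot_scaleE scalerA. Qed.
Fact quot_scale1 : left_id 1 quot_scale.
Proof. by move=> x; rewrite -[x]quot_reprK quot_scaleE scale1r. Qed.
Fact quot_scaleDr : right_distributive quot_scale +%R.
Proof.
move=> a x y; rewrite -[x]quot_reprK -[y]quot_reprK -quot_projD.
by rewrite !quot_scaleE scalerDr quot_projD.
Qed.
Fact quot_scaleDl x : {morph quot_scale^~ x : a b / a + b}.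
Proof.
by move=> a b; rewrite -[x]quot_reprK !quot_scaleE scalerDl quot_projD.
Qed.

HB.instance Definition _ := GRing.Zmodule_isLmodule.Build R quotmod
  quot_scaleA quot_scale1 quot_scaleDr quot_scaleDl.

Fact quot_proj_is_linear : linear quot_proj.
Proof.
by move=> a x y; rewrite quot_projD -quot_scaleE.
Qed.
HB.instance Definition _ := GRing.isLinear.Build R V quotmod *:%R quot_proj
  quot_proj_is_linear.

End QuotientModule.

Record chainComplex (R : pzRingType) := ChainComplex {
  chain :> nat -> lmodType R;
  diff : forall p, {linear chain p.+1 -> chain p};
  diffK : forall p x, diff p (diff p.+1 x) = 0 }.

Record chainMap (R : pzRingType) (C D : chainComplex R) := ChainMap {
  chain_map :> forall p, {linear C p -> D p};
  chain_mapP : forall p x,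
    chain_map p (diff C p x) = diff D p (chain_map p.+1 x) }.

Section Homology.
Variables (R : pzRingType) (C : chainComplex R) (p : nat).

(* Complexes are truncated: every chain of degree 0 is a cycle. *)
Definition cycle_pred : {pred C p} :=
  match p return {pred C p} with
  | 0 => predT
  | q.+1 => [pred x | diff C q x == 0]
  end.

Fact cycle_submod : submod_closed cycle_pred.
Proof.
rewrite /cycle_pred; case: p => [|q]; split => //.
  by rewrite inE raddf0.
by move=> a x y; rewrite !inE linearP => /eqP-> /eqP->; rewrite scaler0 addr0.
Qed.
HB.instance Definition _ := GRing.isSubmodClosed.Build R (C p) cycle_pred
  cycle_submod.

Definition cycles := submodule cycle_pred.
HB.instance Definition _ := GRing.Lmodule.on cycles.

Definition boundary_pred : {pred cycles} :=
  [pred z : cycles | `[< exists y, submodule_val z = diff C p y >]].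

Fact boundary_submod : submod_closed boundary_pred.
Proof.
split; first by rewrite inE; apply/asboolP; exists 0; rewrite !raddf0.
move=> a x y; rewrite !inE => /asboolP[x' xE] /asboolP[y' yE].
by apply/asboolP; exists (a *: x' + y'); rewrite linearP -xE -yE.
Qed.
HB.instance Definition _ := GRing.isSubmodClosed.Build R cycles boundary_pred
  boundary_submod.

Definition homology := quotmod boundary_pred.
HB.instance Definition _ := GRing.Lmodule.on homology.

Definition hclass : {linear cycles -> homology} := @quot_proj R _ boundary_pred.

End Homology.

Arguments cycle_pred {R} C p.
Arguments boundary_pred {R} C p.
Arguments hclass {R} C p.

Section HomologyMap.
Variables (R : pzRingType) (C D : chainComplex R) (f : chainMap C D) (p : nat).

Fact cycle_map_subproof (z : cycles C p) :
  f p (submodule_val z) \in cycle_pred D p.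
Proof.
case: z; rewrite /cycle_pred; case: p => //= q x.
by rewrite !inE -chain_mapP => /eqP->; rewrite raddf0.
Qed.
Definition cycle_map (z : cycles C p) : cycles D p :=
  Submodule (cycle_map_subproof z).

Fact cycle_map_is_linear : linear cycle_map.
Proof. by move=> a x y; apply: val_inj; rewrite /= linearP. Qed.
HB.instance Definition _ := GRing.isLinear.Build R (cycles C p) (cycles D p)
  *:%R cycle_map cycle_map_is_linear.

Definition homology_fun (x : homology C p) : homology D p :=
  hclass D p (cycle_map (quot_repr x)).

Lemma homology_funE z : homology_fun (hclass C p z) = hclass D p (cycle_map z).
Proof.
apply/quot_projP; rewrite -linearB /= inE; apply/asboolP.
have /quot_projP : hclass C p (quot_repr (hclass C p z)) = hclass C p z.
  exact: quot_reprK.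
rewrite inE => /asboolP[y yE]; exists (f p.+1 y).
by rewrite -chain_mapP -yE.
Qed.

Fact homology_fun_is_linear : linear homology_fun.
Proof.
move=> a x y; rewrite -[x]quot_reprK -[y]quot_reprK.
have E u : quot_proj _ u = hclass C p u by [].
by rewrite !E -linearP !homology_funE !linearP.
Qed.
HB.instance Definition _ := GRing.isLinear.Build R (homology C p)
  (homology D p) *:%R homology_fun homology_fun_is_linear.

Definition homology_map : {linear homology C p -> homology D p} := homology_fun.

End HomologyMap.

(* Indices 1, ..., N when L = Some N and 1, 2, ... when L = None. *)
Definition pindex (L : option nat) :=
  {n : nat | (0 < n)%N && (if L is Some N then (n <= N)%N else true)}.

Definition next_index (L : option nat) (i j : pindex L) : Prop := val j = (val i).+1.

Record persModule (R : pzRingType) (L : option nat) := PersModule {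
  pm_obj :> pindex L -> lmodType R;
  pm_map : forall i j, next_index i j -> {linear pm_obj i -> pm_obj j} }.

Record persModuleHom (R : pzRingType) (L : option nat) (M N : persModule R L) :=
  PersModuleHom {
    pmh :> forall i, {linear M i -> N i};
    pmhP : forall i j (ij : next_index i j) x,
      pmh j (pm_map M ij x) = pm_map N ij (pmh i x) }.

Section PersModuleHom.
Variables (R : pzRingType) (L : option nat).
Implicit Types M N P : persModule R L.

Definition pmh_id M : persModuleHom M M :=
  @PersModuleHom R L M M (fun i => idfun) (fun _ _ _ _ => erefl).

Fact pmh_compP M N P (g : persModuleHom N P) (f : persModuleHom M N)
    i j (ij : next_index i j) x :
  (g j \o f j) (pm_map M ij x) = pm_map P ij ((g i \o f i) x).
Proof. by rewrite /= !pmhP. Qed.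
Definition pmh_comp M N P (g : persModuleHom N P) (f : persModuleHom M N) :
    persModuleHom M P :=
  @PersModuleHom R L M P (fun i => g i \o f i) (pmh_compP g f).

Definition pmh_eq M N (f g : persModuleHom M N) := forall i, f i =1 g i.

End PersModuleHom.

Record persComplex (R : pzRingType) (L : option nat) := PersComplex {
  pc_obj :> pindex L -> chainComplex R;
  pc_map : forall i j, next_index i j -> chainMap (pc_obj i) (pc_obj j) }.

Record persComplexHom (R : pzRingType) (L : option nat)
    (C D : persComplex R L) := PersComplexHom {
  pch :> forall i, chainMap (C i) (D i);
  pchP : forall i j (ij : next_index i j) p x,
    pch j p (pc_map C ij p x) = pc_map D ij p (pch i p x) }.

Definition pers_homology (R : pzRingType) (L : option nat)
    (C : persComplex R L) (p : nat) : persModule R L :=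
  PersModule (fun i j ij => homology_map (pc_map C (i := i) (j := j) ij) p).

Fact pers_homology_mapP (R : pzRingType) (L : option nat)
    (C D : persComplex R L) (f : persComplexHom C D) (p : nat)
    i j (ij : next_index i j) (x : pers_homology C p i) :
  homology_map (f j) p (pm_map (pers_homology C p) ij x)
  = pm_map (pers_homology D p) ij (homology_map (f i) p x).
Proof.
rewrite -[x]quot_reprK /= !homology_funE; congr (hclass _ _ _).
by apply: val_inj; rewrite /= pchP.
Qed.

Definition pers_homology_map (R : pzRingType) (L : option nat)
    (C D : persComplex R L) (f : persComplexHom C D) (p : nat) :
    persModuleHom (pers_homology C p) (pers_homology D p) :=
  @PersModuleHom R L (pers_homology C p) (pers_homology D p)
    (fun i => homology_map (f i) p) (pers_homology_mapP f (p := p)).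

(* The free module on sequences of m vertices: Lambda_p(V) is Lambda V p.+1,
   and Lambda_{-1}(V) is Lambda V 0, free on the empty path. *)
Definition Lambda (R : comPzRingType) (V : finType) (m : nat) :=
  {ffun m.-tuple V -> R^o}.
HB.instance Definition _ R V m := GRing.Lmodule.on (Lambda R V m).

Section Basis.
Variables (R : comPzRingType) (V : finType) (m : nat).

Definition epath (t : m.-tuple V) : Lambda R V m := [ffun s => (s == t)%:R].

Lemma epath_sum (v : Lambda R V m) : v = \sum_t v t *: epath t.
Proof.
apply/ffunP => s; rewrite sum_ffunE (bigD1 s) //= big1 ?addr0.
  by rewrite !ffunE eqxx /= /GRing.scale /= mulr1.
by move=> t ts; rewrite !ffunE eq_sym (negPf ts) scaler0.
Qed.

Lemma epathE t s : epath t s = (s == t)%:R.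
Proof. by rewrite ffunE. Qed.

(* The linear map sending each basis element epath t to F t. *)
Definition linext (U : lmodType R) (F : m.-tuple V -> U) (v : Lambda R V m) : U :=
  \sum_t v t *: F t.

Fact linext_is_linear (U : lmodType R) (F : m.-tuple V -> U) : linear (linext F).
Proof.
move=> a x y; rewrite /linext scaler_sumr -big_split /=.
by apply: eq_bigr => t _; rewrite !ffunE scalerDl scalerA.
Qed.
HB.instance Definition _ (U : lmodType R) (F : m.-tuple V -> U) :=
  GRing.isLinear.Build R (Lambda R V m) U *:%R (linext F) (linext_is_linear F).

Lemma linext_epath (U : lmodType R) (F : m.-tuple V -> U) t :
  linext F (epath t) = F t.
Proof.
rewrite /linext (bigD1 t) //= big1 ?addr0 => [|s st]; rewrite epathE.
  by rewrite eqxx scale1r.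
by rewrite (negPf st) scale0r.
Qed.

Lemma linear_ext (U : lmodType R) (g h : {linear Lambda R V m -> U}) :
  (forall t, g (epath t) = h (epath t)) -> g =1 h.
Proof.
move=> gh v; rewrite (epath_sum v) !linear_sum /=.
by apply: eq_bigr => t _; rewrite !linearZZ gh.
Qed.

Definition span (P : pred (m.-tuple V)) : {pred Lambda R V m} :=
  [pred v | `[< exists c : m.-tuple V -> R, v = \sum_(t | P t) c t *: epath t >]].

Fact span_submod P : submod_closed (span P).
Proof.
split.
  rewrite inE; apply/asboolP; exists (fun=> 0).
  by rewrite big1 // => t _; rewrite scale0r.
move=> a x y; rewrite !inE => /asboolP[c ->] /asboolP[d ->].
apply/asboolP; exists (fun t => a * c t + d t).
rewrite scaler_sumr -big_split /=; apply: eq_bigr => t _.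
by rewrite scalerDl scalerA.
Qed.
HB.instance Definition _ P := GRing.isSubmodClosed.Build R (Lambda R V m)
  (span P) (span_submod P).

Lemma epath_span (P : pred (m.-tuple V)) t : P t -> epath t \in span P.
Proof.
move=> Pt; rewrite inE; apply/asboolP; exists (fun s => (s == t)%:R).
rewrite (bigD1 t) //= eqxx scale1r big1 ?addr0 // => s /andP[_ /negPf->].
by rewrite scale0r.
Qed.

Lemma linear_span (U : lmodType R) (g : {linear Lambda R V m -> U})
    (S : submodClosed U) (P : pred (m.-tuple V)) :
  (forall t, P t -> g (epath t) \in S) -> forall v, v \in span P -> g v \in S.
Proof.
move=> gS v; rewrite inE => /asboolP[c ->]; rewrite linear_sum rpred_sum // => t Pt.
by rewrite linearZZ rpredZ // gS.
Qed.

Definition regular (t : m.-tuple V) : bool := sorted (fun i j => i != j) t.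

(* The projection Lambda_p(V) -> R_p(V) killing the non-regular paths. *)
Definition reg : Lambda R V m -> Lambda R V m :=
  linext (fun t => if regular t then epath t else 0).
HB.instance Definition _ := GRing.Linear.on reg.

Lemma reg_epath t : reg (epath t) = if regular t then epath t else 0.
Proof. exact: linext_epath. Qed.

Lemma span_regular (P : pred (m.-tuple V)) :
  (forall t, P t -> regular t) -> forall v, v \in span P -> reg v = v.
Proof.
move=> Pr v; rewrite inE => /asboolP[c ->]; rewrite linear_sum.
by apply: eq_bigr => t Pt; rewrite linearZ /= reg_epath Pr.
Qed.

End Basis.

Section Boundary.
Variables (R : comPzRingType) (V : finType) (w : V -> R).

Definition face m (t : m.+1.-tuple V) (q : 'I_m.+1) : m.-tuple V :=
  [tuple tnth t (lift q i) | i < m].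

Definition bd m : Lambda R V m.+1 -> Lambda R V m :=
  linext (fun t => \sum_(q < m.+1) ((-1) ^+ q * w (tnth t q)) *: epath R (face t q)).
HB.instance Definition _ m := GRing.Linear.on (@bd m).

(* The weighted boundary R_p(V) -> R_{p-1}(V), for m = p, precomposed with the
   projection Lambda_p(V) -> R_p(V): it vanishes on non-regular paths
   (reg_bd_nonregular). *)
Definition rbd m : Lambda R V m.+1 -> Lambda R V m := @reg R V m \o @bd m.
HB.instance Definition _ m := GRing.Linear.on (@rbd m).

Lemma bd_epath m (t : m.+1.-tuple V) :
  bd (epath R t)
  = \sum_(q < m.+1) ((-1) ^+ q * w (tnth t q)) *: epath R (face t q).
Proof. exact: linext_epath. Qed.

Lemma tnth_face m (t : m.+1.-tuple V) q i : tnth (face t q) i = tnth t (lift q i).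
Proof. by rewrite tnth_mktuple. Qed.

Lemma nth_face x0 m (t : m.+1.-tuple V) q i : (i < m)%N ->
  nth x0 (face t q) i = nth x0 t (bump q i).
Proof.
by move=> im; rewrite -(tnth_nth x0 _ (Ordinal im)) tnth_face (tnth_nth x0).
Qed.

Lemma face_face m (t : m.+2.-tuple V) (q r : 'I_m.+1) (q' r' : 'I_m.+2) :
  (q <= r)%N -> q' = q :> nat -> r' = r.+1 :> nat ->
  face (face t q') r = face (face t r') q.
Proof.
move=> qr q'E r'E; apply: eq_from_tnth => i; rewrite !tnth_face.
congr (tnth t _); apply: val_inj; rewrite /= /bump q'E r'E.
by case: (leqP r i); case: (leqP q i) => ? ? /=; lia.
Qed.

Lemma bdK m (v : Lambda R V m.+2) : bd (bd v) = 0.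
Proof.
pose g : {linear Lambda R V m.+2 -> Lambda R V m} := @bd m \o @bd m.+1.
apply: (@linear_ext _ _ _ _ g \0 _ v) => t; rewrite /g /= bd_epath linear_sum /=.
pose T q r := ((-1) ^+ (q : 'I_m.+2) * w (tnth t q)
  * ((-1) ^+ (r : 'I_m.+1) * w (tnth (face t q) r))) *: epath R (face (face t q) r).
rewrite (eq_bigr (fun q => \sum_r T q r)); last first.
  move=> q _; rewrite linearZ /= bd_epath scaler_sumr.
  by apply: eq_bigr => r _; rewrite scalerA.
rewrite pair_big /= (bigID (fun u : 'I_m.+2 * 'I_m.+1 => (u.1 <= u.2)%N)) /=.
rewrite [X in _ + X](reindex_onto
  (fun u : 'I_m.+2 * 'I_m.+1 => (inord u.2.+1, inord u.1) : 'I_m.+2 * 'I_m.+1)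
  (fun u : 'I_m.+2 * 'I_m.+1 => (inord u.2, inord u.1.-1) : 'I_m.+2 * 'I_m.+1)) /=;
  last first.
  move=> [q r] /=; rewrite -ltnNge => rq.
  have qm := ltn_ord q; have rm := ltn_ord r.
  have q1 : (inord q.-1 : 'I_m.+1) = q.-1 :> nat by rewrite inordK; lia.
  have r1 : (inord r : 'I_m.+2) = r :> nat by rewrite inordK; lia.
  congr (_, _); apply: val_inj; rewrite /= ?q1 ?r1 inordK; lia.
rewrite [X in _ + X](eq_bigl (fun u : 'I_m.+2 * 'I_m.+1 => (u.1 <= u.2)%N)); last first.
  move=> [q r] /=; have qm := ltn_ord q; have rm := ltn_ord r.
  rewrite (inordK (_ : r.+1 < m.+2)%N) //=.
  apply/andP/idP => [[] | qr].
    move=> + /eqP[] /(congr1 val) /= + _.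
    have := ltn_ord (inord q : 'I_m.+1); set q' := nat_of_ord (inord q).
    move=> q'm; rewrite inordK; last by lia.
    by move=> + qE; rewrite qE; lia.
  have -> : (inord q : 'I_m.+1) = q :> nat by rewrite inordK; lia.
  split; first by rewrite -ltnNge.
  apply/eqP; congr (_, _); apply: val_inj; rewrite /=.
    by rewrite inordK.
  by rewrite inordK.
rewrite -big_split big1 //= => -[q r] /= qr.
have qm := ltn_ord q; have rm := ltn_ord r.
have q1 : (inord q : 'I_m.+1) = q :> nat by rewrite inordK; lia.
have r1 : (inord r.+1 : 'I_m.+2) = r.+1 :> nat by rewrite inordK.
rewrite /T (@face_face _ t (inord q) r q (inord r.+1)) ?q1 ?r1 //.
rewrite -scalerDl !tnth_face.
have -> : lift q r = inord r.+1.
  by apply: val_inj; rewrite /= r1 /bump qr.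
have -> : lift (inord r.+1) (inord q) = q.
  by apply: val_inj; rewrite /= r1 q1 /bump ltnNge qr.
by rewrite exprS; set a := (-1) ^+ q; set b := (-1) ^+ r; rewrite
  (_ : _ + _ = 0) ?scale0r //; ring.
Qed.

Lemma regularP x0 m (t : m.-tuple V) :
  reflect (forall i, (i.+1 < m)%N -> nth x0 t i != nth x0 t i.+1) (regular t).
Proof.
by apply: (iffP (sortedP x0)); rewrite size_tuple.
Qed.

Lemma reg_bd_nonregular m (t : m.+1.-tuple V) :
  ~~ regular t -> reg (bd (epath R t)) = 0.
Proof.
have x0 : V := thead t.
move=> tN; have [k km tk] : exists2 k, (k.+1 < m.+1)%N & nth x0 t k = nth x0 t k.+1.
  apply: contrapT => H; case/negP: tN; apply/(regularP x0) => i im.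
  by apply/eqP => ti; apply: H; exists i.
rewrite bd_epath linear_sum /=.
pose q0 : 'I_m.+1 := inord k; pose q1 : 'I_m.+1 := inord k.+1.
have q0E : q0 = k :> nat by rewrite inordK; lia.
have q1E : q1 = k.+1 :> nat by rewrite inordK.
have q10 : q1 != q0 by apply/eqP => /(congr1 val) /=; rewrite q0E q1E; lia.
rewrite (bigD1 q0) //= (bigD1 q1) //= big1 ?addr0 => [|q /andP[qq0 qq1]].
  have -> : face t q1 = face t q0.
    apply: eq_from_tnth => i; rewrite !(tnth_nth x0) !nth_face // q0E q1E /bump.
    have [ki|ik] := ltnP k i; first by rewrite (ltnW ki).
    move: ik; rewrite leq_eqVlt => /orP[/eqP->|ik]; first by rewrite leqnn.
    by rewrite leqNgt ik.
  rewrite -linearD -scalerDl !(tnth_nth x0) q0E q1E tk exprS mulN1r mulNr subrr.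
  by rewrite scale0r linear0.
rewrite linearZ /= reg_epath; case: ifP => [|_]; last by rewrite scaler0.
have qk : q != k :> nat by rewrite -q0E.
have qk1 : q != k.+1 :> nat by rewrite -q1E.
have qm := ltn_ord q; move/(regularP x0) => qr; exfalso.
have [qltk|kltq] := ltnP q k.
  have := qr k.-1; rewrite !nth_face; try lia.
  have -> : bump q k.-1 = k by rewrite /bump; lia.
  have -> : bump q k.-1.+1 = k.+1 by rewrite /bump; lia.
  by rewrite tk eqxx => /(_ ltac:(lia)).
have := qr k; rewrite !nth_face; try lia.
have -> : bump q k = k by rewrite /bump; lia.
have -> : bump q k.+1 = k.+1 by rewrite /bump; lia.
by rewrite tk eqxx => /(_ ltac:(lia)).
Qed.

Lemma reg_bd_reg m (v : Lambda R V m.+1) : reg (bd (reg v)) = reg (bd v).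
Proof.
pose g : {linear Lambda R V m.+1 -> Lambda R V m} := @rbd m \o @reg R V m.+1.
apply: (@linear_ext _ _ _ _ g (@rbd m) _ v) => t; rewrite /g /rbd /= reg_epath.
by case: ifPn => // tN; rewrite linear0 /rbd /= (reg_bd_nonregular tN).
Qed.

Lemma rbdK m (v : Lambda R V m.+2) : rbd (rbd v) = 0.
Proof. by rewrite /rbd /= reg_bd_reg bdK linear0. Qed.

End Boundary.

Section Push.
Variables (R : comPzRingType) (V V' : finType) (f : V -> V').

(* The induced map f_#, for sequences of m vertices. *)
Definition push m : Lambda R V m -> Lambda R V' m :=
  linext (fun t => if regular (map_tuple f t) then epath R (map_tuple f t) else 0).
HB.instance Definition _ m := GRing.Linear.on (@push m).

Lemma push_epath m (t : m.-tuple V) :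
  push (epath R t)
  = if regular (map_tuple f t) then epath R (map_tuple f t) else 0.
Proof. exact: linext_epath. Qed.

Lemma push_nonregular m (t : m.-tuple V) : ~~ regular t -> push (epath R t) = 0.
Proof.
move=> tN; rewrite push_epath; case: ifP => // ftr; case/negP: tN.
move: ftr; rewrite /regular /= sorted_map; apply: sub_sorted => i j /=.
by apply: contraNneq => ->.
Qed.

Lemma push_reg m (v : Lambda R V m) : push (reg v) = push v.
Proof.
pose g : {linear Lambda R V m -> Lambda R V' m} := @push m \o @reg R V m.
apply: (@linear_ext _ _ _ _ g (@push m) _ v) => t; rewrite /g /= reg_epath.
by case: ifPn => // /push_nonregular->; rewrite linear0.
Qed.

Lemma push_rbd (w : V -> R) (w' : V' -> R) m (v : Lambda R V m.+1) :
  (forall i, w i = w' (f i)) -> push (rbd w v) = rbd w' (push v).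
Proof.
move=> ww'; rewrite /rbd /= push_reg.
pose g : {linear Lambda R V m.+1 -> Lambda R V' m} := @push m \o @bd R V w m.
pose h : {linear Lambda R V m.+1 -> Lambda R V' m} := @rbd R V' w' m \o @push m.+1.
apply: (@linear_ext _ _ _ _ g h _ v) => t; rewrite /g /h /= push_epath.
have -> : rbd w' (if regular (map_tuple f t) then epath R (map_tuple f t) else 0)
          = reg (bd w' (epath R (map_tuple f t))).
  by case: ifPn => // tN; rewrite linear0 (reg_bd_nonregular _ tN).
rewrite !bd_epath !linear_sum; apply: eq_bigr => q _.
rewrite !linearZ /= push_epath reg_epath tnth_map ww'.
suff -> : face (map_tuple f t) q = map_tuple f (face t q) by [].
by apply: eq_from_tnth => i; rewrite [RHS]tnth_map !tnth_face tnth_map.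
Qed.

End Push.

Record digraph := Digraph {
  vertex :> finType;
  arc : rel vertex;
  arc_irr : irreflexive arc;
  vertex_gt0 : (0 < #|vertex|)%N }.

Record wdigraph (R : comPzRingType) := WDigraph {
  wd_graph :> digraph;
  weight : wd_graph -> R }.

Definition nonvanishing (R : comPzRingType) (G : wdigraph R) : Prop :=
  forall i : G, weight i != 0.

Record wmorphism (R : comPzRingType) (G G' : wdigraph R) := WMorphism {
  wm_fun :> G -> G';
  wm_arc : forall i j, arc i j -> arc (wm_fun i) (wm_fun j) \/ wm_fun i = wm_fun j;
  wm_weight : forall i, weight i = weight (wm_fun i) }.

Section OmegaGamma.
Variables (R : comPzRingType) (G : wdigraph R).

Definition allowed m (t : m.-tuple G) : bool := sorted (@arc G) t.

(* A_p(G) is allowed_mod p.+1, and A_{-1}(G) = R is allowed_mod 0. *)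
Definition allowed_mod m : {pred Lambda R G m} := span (@allowed m).
HB.instance Definition _ m := GRing.SubmodClosed.on (@allowed_mod m).
Arguments allowed_mod m : clear implicits.

Lemma allowed_regular m (t : m.-tuple G) : allowed t -> regular t.
Proof.
by apply: sub_sorted => i j; apply: contraTneq => ->; rewrite arc_irr.
Qed.

Local Notation "'d" := (@rbd R G (@weight R G) _).

Definition Omega_pred p : {pred Lambda R G p.+1} :=
  [pred v | (v \in allowed_mod p.+1) && ('d v \in allowed_mod p)].

Lemma OmegaE p v : (v \in @Omega_pred p)
  = (v \in allowed_mod p.+1) && ('d v \in allowed_mod p).
Proof. by []. Qed.

Fact Omega_submod p : submod_closed (@Omega_pred p).
Proof.
split; first by rewrite OmegaE linear0 !rpred0.
move=> a x y; rewrite !OmegaE => /andP[xA dx] /andP[yA dy].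
by rewrite linearP !rpredD // rpredZ.
Qed.
HB.instance Definition _ p := GRing.isSubmodClosed.Build R (Lambda R G p.+1)
  (@Omega_pred p) (@Omega_submod p).

Definition Gamma_pred p : {pred Lambda R G p.+1} :=
  [pred v | `[< exists a b, [/\ a \in allowed_mod p.+1, b \in allowed_mod p.+2
                              & v = a + 'd b] >]].

Lemma GammaP p v : reflect (exists a b, [/\ a \in allowed_mod p.+1,
    b \in allowed_mod p.+2 & v = a + 'd b]) (v \in @Gamma_pred p).
Proof. exact: asboolP. Qed.

Fact Gamma_submod p : submod_closed (@Gamma_pred p).
Proof.
split.
  apply/GammaP; exists 0, 0.
  by rewrite !rpred0 linear0 addr0.
move=> c x y /GammaP[a [b [aA bA ->]]] /GammaP[a' [b' [aA' bA' ->]]].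
apply/GammaP.
exists (c *: a + a'), (c *: b + b').
by rewrite !rpredD ?rpredZ // linearP scalerDr addrACA.
Qed.
HB.instance Definition _ p := GRing.isSubmodClosed.Build R (Lambda R G p.+1)
  (@Gamma_pred p) (@Gamma_submod p).

Arguments Omega_pred p : clear implicits.
Arguments Gamma_pred p : clear implicits.

Definition Omega p := submodule (Omega_pred p).
HB.instance Definition _ p := GRing.Lmodule.on (Omega p).
Definition Gamma p := submodule (Gamma_pred p).
HB.instance Definition _ p := GRing.Lmodule.on (Gamma p).

Fact Omega_diff_subproof p (x : Omega p.+1) : 'd (submodule_val x) \in Omega_pred p.
Proof.
by case: x => x /=; rewrite !OmegaE => /andP[_ ->]; rewrite rbdK rpred0.
Qed.
Definition Omega_diff p (x : Omega p.+1) : Omega p :=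
  Submodule (Omega_diff_subproof x).
Fact Omega_diff_is_linear p : linear (@Omega_diff p).
Proof. by move=> a x y; apply: val_inj; rewrite /= linearP. Qed.
HB.instance Definition _ p := GRing.isLinear.Build R (Omega p.+1) (Omega p)
  *:%R (@Omega_diff p) (@Omega_diff_is_linear p).
Fact Omega_diffK p x : @Omega_diff p (@Omega_diff p.+1 x) = 0.
Proof. by apply: val_inj; rewrite /= rbdK. Qed.

Fact Gamma_diff_subproof p (x : Gamma p.+1) : 'd (submodule_val x) \in Gamma_pred p.
Proof.
case: x => x /= /GammaP[a [b [aA bA ->]]]; apply/GammaP.
by exists 0, a; rewrite rpred0 linearD /= rbdK addr0 add0r.
Qed.
Definition Gamma_diff p (x : Gamma p.+1) : Gamma p :=
  Submodule (Gamma_diff_subproof x).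
Fact Gamma_diff_is_linear p : linear (@Gamma_diff p).
Proof. by move=> a x y; apply: val_inj; rewrite /= linearP. Qed.
HB.instance Definition _ p := GRing.isLinear.Build R (Gamma p.+1) (Gamma p)
  *:%R (@Gamma_diff p) (@Gamma_diff_is_linear p).
Fact Gamma_diffK p x : @Gamma_diff p (@Gamma_diff p.+1 x) = 0.
Proof. by apply: val_inj; rewrite /= rbdK. Qed.

Definition OmegaC : chainComplex R :=
  @ChainComplex R (fun p => Omega p) (fun p => @Omega_diff p) Omega_diffK.
Definition GammaC : chainComplex R :=
  @ChainComplex R (fun p => Gamma p) (fun p => @Gamma_diff p) Gamma_diffK.

Lemma Omega_sub_Gamma p : {subset Omega_pred p <= Gamma_pred p}.
Proof.
move=> x; rewrite OmegaE => /andP[xA _]; apply/GammaP.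
by exists x, 0; rewrite rpred0 linear0 addr0.
Qed.

Fact iota_subproof p (x : Omega p) : submodule_val x \in Gamma_pred p.
Proof. by case: x => x; apply: Omega_sub_Gamma. Qed.
Definition iota_fun p (x : Omega p) : Gamma p := Submodule (iota_subproof x).
Fact iota_is_linear p : linear (@iota_fun p).
Proof. by move=> a x y; apply: val_inj. Qed.
HB.instance Definition _ p := GRing.isLinear.Build R (Omega p) (Gamma p)
  *:%R (@iota_fun p) (@iota_is_linear p).
Fact iota_chainP p x : @iota_fun p (Omega_diff x) = Gamma_diff (iota_fun x).
Proof. exact: val_inj. Qed.

Definition iota : chainMap OmegaC GammaC :=
  @ChainMap R OmegaC GammaC (fun p => @iota_fun p) iota_chainP.

End OmegaGamma.

Arguments Omega_pred {R} G p.
Arguments Gamma_pred {R} G p.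
Arguments allowed_mod {R} G m.

Section Induced.
Variables (R : comPzRingType) (G G' : wdigraph R) (f : wmorphism G G').

Lemma push_allowed m (v : Lambda R G m) :
  v \in allowed_mod G m -> push f v \in allowed_mod G' m.
Proof.
apply: (@linear_span R G m _ (@push R G G' f m) (allowed_mod G' m)).
move=> t tA; rewrite /= push_epath; case: ifP => [tr|]; last by rewrite rpred0.
apply: epath_span; rewrite /allowed /=.
case: m t tA tr {v} => [|m] t tA tr; first by rewrite tuple0.
have x0 : G := thead t.
move/(regularP (f x0)): tr => tr; apply/(sortedP (f x0)) => i.
rewrite size_map size_tuple => im.
have := tr i im; rewrite /= !(nth_map x0) ?size_tuple //; last by lia.
move/sortedP: tA => /(_ x0 i); rewrite size_tuple => /(_ im) /(wm_arc f).
by case=> // ->; rewrite eqxx.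
Qed.

Lemma wpush_rbd m (v : Lambda R G m.+1) :
  push f (rbd (@weight R G) v) = rbd (@weight R G') (push f v).
Proof. exact: push_rbd (wm_weight f). Qed.

Fact Omega_map_subproof p (x : Omega G p) : push f (submodule_val x) \in Omega_pred G' p.
Proof.
case: x => x /=; rewrite !OmegaE => /andP[xA dxA].
by rewrite -wpush_rbd !push_allowed.
Qed.
Definition Omega_map_fun p (x : Omega G p) : Omega G' p :=
  Submodule (Omega_map_subproof x).
Fact Omega_map_is_linear p : linear (@Omega_map_fun p).
Proof. by move=> a x y; apply: val_inj; rewrite /= linearP. Qed.
HB.instance Definition _ p := GRing.isLinear.Build R (Omega G p) (Omega G' p)
  *:%R (@Omega_map_fun p) (@Omega_map_is_linear p).
Fact Omega_map_chainP p x :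
  @Omega_map_fun p (Omega_diff x) = Omega_diff (Omega_map_fun x).
Proof. by apply: val_inj; rewrite /= wpush_rbd. Qed.
Definition Omega_map : chainMap (OmegaC G) (OmegaC G') :=
  @ChainMap R (OmegaC G) (OmegaC G') (fun p => @Omega_map_fun p)
    Omega_map_chainP.

Fact Gamma_map_subproof p (x : Gamma G p) : push f (submodule_val x) \in Gamma_pred G' p.
Proof.
case: x => x /= /GammaP[a [b [aA bA ->]]]; apply/GammaP.
by exists (push f a), (push f b); rewrite !push_allowed // linearD /= wpush_rbd.
Qed.
Definition Gamma_map_fun p (x : Gamma G p) : Gamma G' p :=
  Submodule (Gamma_map_subproof x).
Fact Gamma_map_is_linear p : linear (@Gamma_map_fun p).
Proof. by move=> a x y; apply: val_inj; rewrite /= linearP. Qed.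
HB.instance Definition _ p := GRing.isLinear.Build R (Gamma G p) (Gamma G' p)
  *:%R (@Gamma_map_fun p) (@Gamma_map_is_linear p).
Fact Gamma_map_chainP p x :
  @Gamma_map_fun p (Gamma_diff x) = Gamma_diff (Gamma_map_fun x).
Proof. by apply: val_inj; rewrite /= wpush_rbd. Qed.
Definition Gamma_map : chainMap (GammaC G) (GammaC G') :=
  @ChainMap R (GammaC G) (GammaC G') (fun p => @Gamma_map_fun p)
    Gamma_map_chainP.

Lemma iota_map p x : iota G' p (Omega_map p x) = Gamma_map p (iota G p x).
Proof. exact: val_inj. Qed.

End Induced.

Section Sequence.
Variables (R : comPzRingType) (L : option nat) (G : pindex L -> wdigraph R).
Variable f : forall i j, next_index i j -> wmorphism (G i) (G j).

Definition Omega_pers : persComplex R L :=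
  @PersComplex R L (fun i => OmegaC (G i)) (fun i j ij => Omega_map (f ij)).

Definition Gamma_pers : persComplex R L :=
  @PersComplex R L (fun i => GammaC (G i)) (fun i j ij => Gamma_map (f ij)).

Definition iota_pers : persComplexHom Omega_pers Gamma_pers :=
  @PersComplexHom R L Omega_pers Gamma_pers (fun i => iota (G i))
    (fun i j ij => iota_map (f ij)).

Definition pers_wpath_homology (p : nat) : persModule R L :=
  pers_homology Omega_pers p.

End Sequence.

(* Main.v *)
From HB Require Import structures.
Require Import Defs.
From mathcomp Require Import all_boot all_order all_algebra.
From mathcomp Require Import boolp.

(* Write a cycle of Gamma_p as a + db with a, b allowed.  Then da = 0, so a is a
   cycle of Omega_p homologous to it.  If a cycle z of Omega_p is the boundary
   of a + db in Gamma_{p+1}, then z = da, and a lies in Omega_{p+1} because da = z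
   is allowed.  Hence each inclusion is a quasi-isomorphism, and the inverses on
   homology commute with the induced maps because the inclusions do. *)

Set Implicit Arguments.
Unset Strict Implicit.
Unset Printing Implicit Defensive.

Import GRing.Theory.
Local Open Scope ring_scope.

(** Inverses chosen degree by degree inherit linearity from [h]; they commute with the structure
    maps because [h] does and each [h j] is injective. *)
Lemma pmh_inverse (R : pzRingType) (L : option nat) (M N : persModule R L)
    (h : persModuleHom M N) :
  (forall i, injective (h i)) -> (forall i y, exists x, h i x = y) ->
  exists g : persModuleHom N M,
    pmh_eq (pmh_comp g h) (pmh_id M) /\ pmh_eq (pmh_comp h g) (pmh_id N).
Proof.
move=> h_inj h_surj.
pose g i y := sval (cid (h_surj i y)).
have gK i : cancel (g i) (h i) by move=> y; rewrite /g; case: cid.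
have hK i : cancel (h i) (g i) by move=> x; apply: (h_inj i); rewrite gK.
pose gl i : {linear N i -> M i} :=
  HB.pack (g i) (GRing.isLinear.Build R (N i) (M i) *:%R (g i)
    (can2_linear (hK i) (gK i))).
have g_comm i j (ij : next_index i j) x :
    gl j (pm_map N ij x) = pm_map M ij (gl i x).
  by apply: (h_inj j); rewrite pmhP /= !gK.
by exists (PersModuleHom g_comm); split=> i x /=; rewrite ?hK ?gK.
Qed.

Section HomologyClasses.
Variables (R : pzRingType) (C : chainComplex R) (p : nat).

Lemma hclass_surj (x : homology C p) : exists z, hclass C p z = x.
Proof. by exists (quot_repr x); apply: quot_reprK. Qed.

Lemma hclass_eqP (z z' : cycles C p) :
  hclass C p z = hclass C p z' <->
  exists y, submodule_val z - submodule_val z' = diff C p y.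
Proof.
by split=> [/quot_projP|zz']; [rewrite inE => /asboolP
  | apply/quot_projP; rewrite inE; apply/asboolP].
Qed.

End HomologyClasses.

Section OmegaGammaIso.
Variables (R : comPzRingType) (G : wdigraph R).

(** The empty path is vacuously allowed, so the boundary condition defining [Omega_pred] is
    automatic in degree 0. *)
Lemma allowed_mod0 (v : Lambda R G 0) : v \in allowed_mod G 0.
Proof.
rewrite (epath_sum v) rpred_sum // => t _; rewrite rpredZ //.
by apply: epath_span; rewrite tuple0.
Qed.

Lemma allowed_Gamma p (b : Lambda R G p.+1) :
  b \in allowed_mod G p.+1 -> b \in Gamma_pred G p.
Proof. by move=> bA; apply/GammaP; exists b, 0; rewrite rpred0 linear0 addr0. Qed.

Lemma iota_homology_inj p : injective (homology_map (Defs.iota G) p).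
Proof.
move=> x x'; have [z <-] := hclass_surj x; have [z' <-] := hclass_surj x'.
rewrite /= !homology_funE => /hclass_eqP[[y yG]] /(congr1 val) /= zz'.
apply/hclass_eqP; have /GammaP[a [b [aA _ yE]]] := yG.
have daE : rbd (@weight R G) a
    = submodule_val (submodule_val z - submodule_val z').
  by rewrite [RHS]zz' yE linearD /= rbdK addr0.
(* [daE] equates the boundary of [a] with an element of [Omega G p], which is allowed. *)
have aO : a \in Omega_pred G p.+1.
  rewrite OmegaE aA daE.
  have := valP (submodule_val z - submodule_val z' : Omega G p).
  by rewrite OmegaE => /andP[].
by exists (Submodule aO : Omega G p.+1); apply: val_inj; rewrite /= daE.
Qed.

Lemma iota_homology_surj p y : exists x, homology_map (Defs.iota G) p x = y.
Proof.
have [[[z zG] zZ] <-] := hclass_surj y; have /GammaP[a [b [aA bA zE]]] := zG.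
(* By truncation, a cycle of degree 0 may have nonzero [rbd], so this degree is treated apart; in
   positive degree, the boundary of [a] vanishes. *)
have [daA aZ] : rbd (@weight R G) a \in allowed_mod G p
    /\ (forall aO : a \in Omega_pred G p,
          (Submodule aO : Omega G p) \in cycle_pred (OmegaC G) p).
  case: p => [|q] in y z zG zZ a b aA bA zE *.
    by split=> //; apply: allowed_mod0.
  have da0 : rbd (@weight R G) a = 0.
    move: (zZ); rewrite inE => /eqP/(congr1 val) /=.
    by rewrite zE linearD /= rbdK addr0.
  by split=> [|aO]; rewrite ?da0 ?rpred0 // inE; apply/eqP/val_inj.
have aO : a \in Omega_pred G p by rewrite OmegaE aA daA.
exists (hclass (OmegaC G) p (Submodule (aZ aO))).
rewrite /= homology_funE; apply/hclass_eqP.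
(* The sign comes from a - (a + db) = d(-b). *)
exists (- (Submodule (allowed_Gamma bA) : Gamma G p.+1)); apply: val_inj => /=.
by rewrite linearN /= zE opprD addrA subrr add0r.
Qed.

End OmegaGammaIso.

(* theta identifies, as persistence modules, the homology of Gamma with
   H_p(G_n, w_n; R); it is the inverse of the isomorphism on homology. *)
Theorem theorem4p1 (R : comPzRingType) (L : option nat)
    (G : pindex L -> wdigraph R) (hw : forall n, nonvanishing (G n))
    (f : forall m n : pindex L, next_index m n -> wmorphism (G m) (G n))
    (p : nat) :
  exists theta : persModuleHom (pers_homology (Gamma_pers f) p)
                               (pers_wpath_homology f p),
    pmh_eq (pmh_comp theta (pers_homology_map (iota_pers f) p))
           (pmh_id (pers_wpath_homology f p))
    /\ pmh_eq (pmh_comp (pers_homology_map (iota_pers f) p) theta)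
              (pmh_id (pers_homology (Gamma_pers f) p)).
Proof.
apply: pmh_inverse => i.
  exact: iota_homology_inj.
exact: iota_homology_surj.
Qed.
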